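(* Let $n\ge2$, $[n]=\{1,\dots,n\}$, $[n]^+=\{2,\dots,n\}$, $\gamma\in(0,1)$, $\gamma_i=\gamma(1-\gamma)^{i-1}$ for $i\in[n-1]$ and $\gamma_n=(1-\gamma)^{n-1}$. Under the standing assumptions (A1), (A2) of the context, let $\hat{\bm{z}}\in\mathcal{Z}\cap\{0,1\}^m$ be given and let BSP be the Benders subproblem, with variables $\bm{x}_i,\bm{y}_i,\bm{v}_{yi},\bm{u}_{xi},\bm{u}_{yi}\ge0$ ($i\in[n]$), $\bm{u}\ge0$ and a scalar $\bm{w}\ge0$: $$\max\ \sum_{i=1}^n\Big(\bm{y}_i^T(b_i-D_i\hat{\bm{z}})+\bm{u}_{xi}^T(b_{xi}-H_{xi}\hat{\bm{z}})\Big)-\Big[\sum_{i=1}^n\Big(\gamma_ic_i^T\bm{x}_i-\gamma_i\bm{u}_{yi}^T(b_{yi}-H_{yi}\hat{\bm{z}})-\gamma_i\bm{v}_{yi}^T(e_{yi}+E_{yi}\hat{\bm{z}})\Big)-\bm{u}^T(q_y-R_y\hat{\bm{z}})\Big]$$ subject to $$\bm{y}_i^TA_i+\bm{y}_{i+1}^TB_{i+1}+G_{xi}^T\bm{u}_{xi}\le\gamma_ic_i^T\bm{w}+\gamma c_{xi}^T,\quad i\in[n-1],$$ $$\bm{y}_n^TA_n+G_{xn}^T\bm{u}_{xn}\le\gamma_nc_n^T\bm{w}+\gamma c_{xn}^T,$$ $$A_1\bm{x}_1-G_{y1}^T\bm{u}_{y1}-Y_{y1}^T\bm{v}_{y1}-S_{y1}^T\bm{u}/\gamma_1\ge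 b_1\bm{w},$$ $$A_i\bm{x}_i+B_i\bm{x}_{i-1}-G_{yi}^T\bm{u}_{yi}-Y_{yi}^T\bm{v}_{yi}-S_{yi}^T\bm{u}/\gamma_i\ge b_i\bm{w},\quad i\in[n]^+,$$ $$K_{yi}^T\bm{v}_{yi}\le\bm{w}\mathbf{1},\quad i\in[n].$$ Then BSP can be solved by solving the following two problems sequentially. First, solve BSP1: $$\min_{\bm{x},\bm{u}_y,\bm{v}_y,\bm{u}\ge0}\ \sum_{i=1}^n\Big(\gamma_ic_i^T\bm{x}_i-\gamma_i\bm{u}_{yi}^T(b_{yi}-H_{yi}\hat{\bm{z}})-\gamma_i\bm{v}_{yi}^T(e_{yi}+E_{yi}\hat{\bm{z}})\Big)-\bm{u}^T(q_y-R_y\hat{\bm{z}})$$ $$\text{s.t.}\quad A_1\bm{x}_1-G_{y1}^T\bm{u}_{y1}-Y_{y1}^T\bm{v}_{y1}-S_{y1}^T\bm{u}/\gamma_1\ge b_1,$$ $$A_i\bm{x}_i+B_i\bm{x}_{i-1}-G_{yi}^T\bm{u}_{yi}-Y_{yi}^T\bm{v}_{yi}-S_{yi}^T\bm{u}/\gamma_i\ge b_i,\quad i\in[n]^+,$$ $$K_{yi}^T\bm{v}_{yi}\le\mathbf{1},\quad i\in[n].$$ Then solve BSP2, where $\mathfrak{D}$ is the optimal value of BSP1 if it has a finite optimum and $\mathfrak{D}=\infty$ otherwise (in which case this means fixing $\bm{w}=0$): $$\max_{\bm{y},\bm{u}_x,\bm{w}\ge0}\ \sum_{i=1}^n\Big(\bm{y}_i^T(b_i-D_i\hat{\bm{z}})+\bm{u}_{xi}^T(b_{xi}-H_{xi}\hat{\bm{z}})\Big)-\bm{w}\mathfrak{D}$$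 $$\text{s.t.}\quad\bm{y}_i^TA_i+\bm{y}_{i+1}^TB_{i+1}+G_{xi}^T\bm{u}_{xi}\le\gamma_ic_i^T\bm{w}+\gamma c_{xi}^T,\quad i\in[n-1],$$ $$\bm{y}_n^TA_n+G_{xn}^T\bm{u}_{xn}\le\gamma_nc_n^T\bm{w}+\gamma c_{xn}^T.$$
   Context: Setting. The data are vectors $c_z,c_{xi},b_{xi},b_{yi},q_y,c_i,b_i,e_{yi}$ and matrices $H_{xi},G_{xi},H_{yi},G_{yi},R_y,S_{yi},A_i,D_i,Y_{yi},K_{yi},E_{yi}$ ($i\in[n]$), $B_i$ ($i\in[n]^+$) of appropriate dimensions, and a set $\mathcal{Z}$ of binary vectors of dimension $m$. They come from a multi-level problem whose upper level chooses $\bm{z}\in\mathcal{Z}\cap\{0,1\}^m$ to minimize $c_z^T\bm{z}+\sum_ic_{xi}^T\bm{x}_i$ subject to $H_{xi}\bm{z}+G_{xi}\bm{x}_i\ge b_{xi}$, $H_{yi}\bm{z}+G_{yi}\bm{y}_i\ge b_{yi}$ ($i\in[n]$), $R_y\bm{z}+\sum_iS_{yi}\bm{y}_i\ge q_y$, and whose $i$-th sequential lower level is $\min_{\bm{x}_i\ge0}c_i^T\bm{x}_i$ s.t. $A_i\bm{x}_i+B_i\bm{x}_{i-1}+D_i\bm{z}\ge b_i$ (no $B$-term for $i=1$), with dual vector $\bm{y}_i\ge0$. $\mathbf{1}$ is the all-ones vector. For fixed $\hat{\bm{z}}$, BSP is the linear programming dual of the following linear program in $\bm{x}_i,\bm{y}_i,\bm{s}_{yi}\ge0$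 (the single-level approximation with $\bm{z}$ fixed): minimize $\sum_i\gamma c_{xi}^T\bm{x}_i$ subject to $H_{xi}\hat{\bm{z}}+G_{xi}\bm{x}_i\ge b_{xi}$ [dual $\bm{u}_{xi}$]; $\gamma_iH_{yi}\hat{\bm{z}}+G_{yi}\bm{y}_i\ge\gamma_ib_{yi}$ [$\bm{u}_{yi}$]; $R_y\hat{\bm{z}}+\sum_iS_{yi}\bm{y}_i/\gamma_i\ge q_y$ [$\bm{u}$]; $A_1\bm{x}_1+D_1\hat{\bm{z}}\ge b_1$ and $A_i\bm{x}_i+B_i\bm{x}_{i-1}+D_i\hat{\bm{z}}\ge b_i$, $i\in[n]^+$ [$\bm{y}_i$]; $\bm{y}_i^TA_i+\bm{y}_{i+1}^TB_{i+1}\le\gamma_ic_i^T$, $i\in[n-1]$, and $\bm{y}_n^TA_n\le\gamma_nc_n^T$ [$\bm{x}_i$]; $\sum_i(\bm{y}_i^Tb_i-\bm{s}_{yi}^T\mathbf{1})\ge\sum_i\gamma_ic_i^T\bm{x}_i$ [$\bm{w}$]; and the McCormick linearization $Y_{yi}\bm{y}_i+K_{yi}\bm{s}_{yi}\ge\gamma_i(e_{yi}+E_{yi}\hat{\bm{z}})$ of $\bm{s}_{yi}^T\mathbf{1}=\bm{y}_i^TD_i\hat{\bm{z}}$ [$\bm{v}_{yi}$]. Standing assumptions. (A1) Minimizing $c_z^T\bm{z}+\sum_ic_{xi}^T\bm{x}_i$ over $\bm{z}\in\mathcal{Z}\cap\{0,1\}^m$, $\bm{x}_i,\bm{y}_i\ge0$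 subject to the upper-level constraints above and the lower-level primal constraints $A_i\bm{x}_i+B_i\bm{x}_{i-1}+D_i\bm{z}\ge b_i$ is feasible and bounded. (A2) For every upper-level decision $\hat{\bm{z}}$, Slater's constraint qualification holds for the sequential lower-level problems. Here ''BSP can be solved by'' two problems means that the outcome of BSP, and hence the Benders cut it generates, can be obtained from the outcomes of solving the two problems in the indicated way. *)

(* Defs.v *)
From mathcomp Require Import all_boot all_order all_algebra.
From mathcomp Require Import reals constructive_ereal.

Set Implicit Arguments.
Unset Strict Implicit.
Unset Printing Implicit Defensive.

Import Order.TTheory GRing.Theory Num.Theory.
Local Open Scope ring_scope.

Definition lev (R : realType) (k : nat) (u v : 'cV[R]_k) : Prop :=
  forall r, u r 0 <= v r 0.
Definition ltv (R : realType) (k : nat) (u v : 'cV[R]_k) : Prop :=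
  forall r, u r 0 < v r 0.
Definition dot (R : realType) (k : nat) (u v : 'cV[R]_k) : R := (u^T *m v) 0 0.
Definition ones (R : realType) (k : nat) : 'cV[R]_k := const_mx 1.

Notation "u <=v v" := (lev u v) (at level 70, no associativity).
Notation "u <v v" := (ltv u v) (at level 70, no associativity).

(** * Linear programs and their outcomes *)

(* [recession] is the homogenized constraint system, i.e. the recession cone of
   the feasible polyhedron. *)
Record lp (R : realType) (V : Type) := LP {
  feasible : V -> Prop;
  recession : V -> Prop;
  objective : V -> R }.

(* [Unbounded p r]: a feasible point [p] together with an improving ray [r].
   A Benders cut is read off the optimal solution (optimality cut) or off the
   ray (feasibility cut). *)
Inductive outcome (V : Type) :=
  | Infeasible
  | Unbounded of V & V
  | Optimal of V.
Arguments Infeasible {V}.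

Definition max_outcome (R : realType) (V : Type) (L : lp R V) (o : outcome V) :
    Prop :=
  match o with
  | Infeasible => forall p, ~ feasible L p
  | Unbounded p r => [/\ feasible L p, recession L r & 0 < objective L r]
  | Optimal p =>
      feasible L p /\ forall q, feasible L q -> objective L q <= objective L p
  end.

Definition min_outcome (R : realType) (V : Type) (L : lp R V) (o : outcome V) :
    Prop :=
  match o with
  | Infeasible => forall p, ~ feasible L p
  | Unbounded p r => [/\ feasible L p, recession L r & objective L r < 0]
  | Optimal p =>
      feasible L p /\ forall q, feasible L q -> objective L p <= objective L q
  end.

(** * Data *)

(* The levels 1..n are indexed by 'I_n, i.e. from 0.  All dimensions may depend
   on the level.  Of the matrices [B_ i j] only those with i = j + 1 are ever
   used: [B_ i j] is then the B-matrix of level i, acting on x_j = x_(i-1). *)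
Record data (R : realType) (n m : nat) := Data {
  dx : 'I_n -> nat;
  dy : 'I_n -> nat;
  ds : 'I_n -> nat;
  dux : 'I_n -> nat;
  duy : 'I_n -> nat;
  dv : 'I_n -> nat;
  du : nat;
  Z_ : 'cV[R]_m -> Prop;
  c_z : 'cV[R]_m;
  c_x : forall i, 'cV[R]_(dx i);
  H_x : forall i, 'M[R]_(dux i, m);
  G_x : forall i, 'M[R]_(dux i, dx i);
  b_x : forall i, 'cV[R]_(dux i);
  H_y : forall i, 'M[R]_(duy i, m);
  G_y : forall i, 'M[R]_(duy i, dy i);
  b_y : forall i, 'cV[R]_(duy i);
  R_y : 'M[R]_(du, m);
  S_y : forall i, 'M[R]_(du, dy i);
  q_y : 'cV[R]_du;
  c_ : forall i, 'cV[R]_(dx i);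
  A_ : forall i, 'M[R]_(dy i, dx i);
  B_ : forall i j, 'M[R]_(dy i, dx j);
  D_ : forall i, 'M[R]_(dy i, m);
  b_ : forall i, 'cV[R]_(dy i);
  Y_y : forall i, 'M[R]_(dv i, dy i);
  K_y : forall i, 'M[R]_(dv i, ds i);
  E_y : forall i, 'M[R]_(dv i, m);
  e_y : forall i, 'cV[R]_(dv i) }.

Section Problem.
Variables (R : realType) (n m : nat) (P : data R n m) (gamma : R).

Definition xvar := forall i : 'I_n, 'cV[R]_(dx P i).
Definition yvar := forall i : 'I_n, 'cV[R]_(dy P i).
Definition uxvar := forall i : 'I_n, 'cV[R]_(dux P i).
Definition uyvar := forall i : 'I_n, 'cV[R]_(duy P i).
Definition vvar := forall i : 'I_n, 'cV[R]_(dv P i).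

Definition gam (i : 'I_n) : R :=
  if (i.+1 < n)%N then gamma * (1 - gamma) ^+ i else (1 - gamma) ^+ n.-1.

Definition upper_decision (z : 'cV[R]_m) : Prop :=
  Z_ P z /\ forall k, z k 0 = 0 \/ z k 0 = 1.

(* A_i x_i + B_i x_(i-1); the sum is empty at the first level. *)
Definition primal_lhs (x : xvar) (i : 'I_n) : 'cV[R]_(dy P i) :=
  A_ P i *m x i + \sum_(j < n | i == j.+1 :> nat) B_ P i j *m x j.

(* The transpose of y_i^T A_i + y_(i+1)^T B_(i+1); the sum is empty at the last
   level. *)
Definition dual_lhs (y : yvar) (i : 'I_n) : 'cV[R]_(dx P i) :=
  (A_ P i)^T *m y i + \sum_(j < n | j == i.+1 :> nat) (B_ P j i)^T *m y j.

(** * Standing assumptions *)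

Definition relaxation_feasible (z : 'cV[R]_m) (x : xvar) (y : yvar) : Prop :=
  [/\ upper_decision z,
      forall i, 0 <=v x i /\ 0 <=v y i,
      forall i, b_x P i <=v H_x P i *m z + G_x P i *m x i
             /\ b_y P i <=v H_y P i *m z + G_y P i *m y i,
      q_y P <=v R_y P *m z + \sum_i S_y P i *m y i
    & forall i, b_ P i <=v primal_lhs x i + D_ P i *m z].

Definition relaxation_objective (z : 'cV[R]_m) (x : xvar) : R :=
  dot (c_z P) z + \sum_i dot (c_x P i) (x i).

Definition relaxation_feasible_bounded : Prop :=
  (exists z x y, relaxation_feasible z x y) /\
  (exists l, forall z x y,
     relaxation_feasible z x y -> l <= relaxation_objective z x).

Definition slater (z : 'cV[R]_m) : Prop :=
  exists x : xvar,
    forall i, 0 <v x i /\ b_ P i <v primal_lhs x i + D_ P i *m z.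

Definition mccormick (z : 'cV[R]_m) (i : 'I_n) (y : 'cV[R]_(dy P i))
    (s : 'cV[R]_(ds P i)) : Prop :=
  [/\ 0 <=v y, 0 <=v s
    & gam i *: (e_y P i + E_y P i *m z) <=v Y_y P i *m y + K_y P i *m s].

(* What makes the system above a McCormick linearization of the bilinear term
   s_i^T 1 = y_i^T D_i z: it is consistent, and exact at binary z. *)
Definition linearizes (z : 'cV[R]_m) : Prop :=
  forall i, (exists y s, @mccormick z i y s) /\
    (forall y s, @mccormick z i y s ->
       dot s (ones R (ds P i)) = dot y (D_ P i *m z)).

(** * The Benders subproblem and its two parts *)

Record var1 := Var1 { x1 : xvar; uy1 : uyvar; v1 : vvar; u1 : 'cV[R]_(du P) }.
Record var2 := Var2 { y2 : yvar; ux2 : uxvar; w2 : R }.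

Definition zero1 : var1 := Var1 (fun=> 0) (fun=> 0) (fun=> 0) 0.
Definition zero2 : var2 := Var2 (fun=> 0) (fun=> 0) 0.
Definition scale1 (a : R) (t : var1) : var1 :=
  Var1 (fun i => a *: x1 t i) (fun i => a *: uy1 t i) (fun i => a *: v1 t i)
       (a *: u1 t).

(* The constraints on (x, u_y, v_y, u), with right-hand sides b_i w and w 1:
   those of BSP as they stand, of BSP1 for w = 1, and of the recession cone of
   BSP1 for w = 0. *)
Definition constr1 (w : R) (t : var1) : Prop :=
  [/\ forall i, [/\ 0 <=v x1 t i, 0 <=v uy1 t i & 0 <=v v1 t i],
      0 <=v u1 t,
      forall i, w *: b_ P i <=v
        primal_lhs (x1 t) i - (G_y P i)^T *m uy1 t i - (Y_y P i)^T *m v1 t i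
          - (gam i)^-1 *: ((S_y P i)^T *m u1 t)
    & forall i, (K_y P i)^T *m v1 t i <=v w *: ones R (ds P i)].

(* The constraints on (y, u_x, w), for h = 1, and their homogenization, for
   h = 0. *)
Definition constr2 (h : R) (t : var2) : Prop :=
  [/\ forall i, 0 <=v y2 t i /\ 0 <=v ux2 t i,
      0 <= w2 t
    & forall i, dual_lhs (y2 t) i + (G_x P i)^T *m ux2 t i <=v
        (gam i * w2 t) *: c_ P i + (h * gamma) *: c_x P i].

Definition objective1 (z : 'cV[R]_m) (t : var1) : R :=
  \sum_i (gam i * dot (c_ P i) (x1 t i)
          - gam i * dot (uy1 t i) (b_y P i - H_y P i *m z)
          - gam i * dot (v1 t i) (e_y P i + E_y P i *m z))
  - dot (u1 t) (q_y P - R_y P *m z).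

Definition objective2 (z : 'cV[R]_m) (t : var2) : R :=
  \sum_i (dot (y2 t i) (b_ P i - D_ P i *m z)
          + dot (ux2 t i) (b_x P i - H_x P i *m z)).

(* To be maximized. *)
Definition BSP (z : 'cV[R]_m) : lp R (var2 * var1) := {|
  feasible t := constr2 1 t.1 /\ constr1 (w2 t.1) t.2;
  recession t := constr2 0 t.1 /\ constr1 (w2 t.1) t.2;
  objective t := objective2 z t.1 - objective1 z t.2 |}.

(* To be minimized. *)
Definition BSP1 (z : 'cV[R]_m) : lp R var1 := {|
  feasible := constr1 1;
  recession := constr1 0;
  objective := objective1 z |}.

(* To be maximized.  [d = +oo] means that w is fixed to 0; the term w d is then
   0, in accordance with [fine +oo = 0]. *)
Definition BSP2 (z : 'cV[R]_m) (d : \bar R) : lp R var2 := {|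
  feasible t := constr2 1 t /\ (d = +oo%E -> w2 t = 0);
  recession t := constr2 0 t /\ (d = +oo%E -> w2 t = 0);
  objective t := objective2 z t - w2 t * fine d |}.

Definition value1 (z : 'cV[R]_m) (o1 : outcome var1) : \bar R :=
  if o1 is Optimal t then (objective1 z t)%:E else +oo%E.

(* The BSP1-part of a point or ray of BSP whose BSP2-part is [t]. *)
Definition fill (o1 : outcome var1) (t : var2) : var1 :=
  if o1 is Optimal t1 then scale1 (w2 t) t1 else zero1.

(* If BSP1 is unbounded, its ray, joined with zeros, is an improving ray of BSP,
   which is therefore unbounded even when BSP2, with w = 0, has an optimum. *)
Definition combine (o1 : outcome var1) (o2 : outcome var2) :
    outcome (var2 * var1) :=
  match o2 with
  | Infeasible => Infeasible
  | Unbounded p r => Unbounded (p, fill o1 p) (r, fill o1 r)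
  | Optimal p =>
      if o1 is Unbounded _ r1 then Unbounded (p, zero1) (zero2, r1)
      else Optimal (p, fill o1 p)
  end.

End Problem.

(* Main.v *)
(* BSP splits into BSP2, which carries w, and the cone over BSP1: for w > 0 the
   BSP1-part of a point is w times a feasible point of BSP1, for w = 0 it is a
   recession direction of BSP1.  Its best value is therefore w times the optimal
   value of BSP1 when that is finite; when BSP1 is unbounded, its ray makes BSP
   unbounded as soon as BSP is feasible.  It remains to see, by Farkas' lemma,
   that BSP1 is feasible (Slater and the exactness of the McCormick system) and
   that BSP2 is feasible with w = 0 (boundedness of the relaxation). *)

Require Import Defs.
From mathcomp Require Import all_boot all_order all_algebra.
From mathcomp Require Import reals constructive_ereal.
From mathcomp Require Import boolp classical_sets ring lra.

Set Implicit Arguments.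
Unset Strict Implicit.
Unset Printing Implicit Defensive.

Import Order.TTheory GRing.Theory Num.Theory.
Local Open Scope ring_scope.

(* Farkas' lemma only evaluates functionals at combinations a x + y, so a bare
   type with such an operation, and no module axioms, suffices.  This avoids
   flattening records of level-indexed vectors into one matrix. *)
Definition linear_for (R : realType) (V : Type) (comb : R -> V -> V -> V)
    (f : V -> R) : Prop :=
  forall a x y, f (comb a x y) = a * f x + f y.

(** * Farkas' lemma for finitely many functionals *)

Section LinearInequalities.
Variables (R : realType) (V : Type) (comb : R -> V -> V -> V).
Local Notation lin := (linear_for comb).

Lemma farkas_ord k (f : 'I_k -> V -> R) (g : V -> R) :
  (forall i, lin (f i)) -> lin g ->
  (forall x, (forall i, 0 <= f i x) -> 0 <= g x) ->
  exists l : 'I_k -> R, (forall i, 0 <= l i) /\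
    forall x, g x = \sum_i l i * f i x.
Proof.
elim: k => [|k IHk] in f g *.
  move=> _ g_lin g_ge0; exists (fun=> 0); split=> // x; rewrite big_ord0.
  have g_pos y : 0 <= g y by apply: g_ge0; case.
  (* [comb (-2) x x] plays the part of [- x]: there [g] takes the value [- g x]. *)
  have := g_pos (comb (-2) x x); have := g_pos x.
  by rewrite g_lin; lra.
move=> f_lin g_lin fg.
pose h := f ord_max; pose f0 i := f (lift ord_max i).
have h_lin : lin h by apply: f_lin.
have f0_lin i : lin (f0 i) by apply: f_lin.
have f_split x : (forall i, 0 <= f0 i x) -> 0 <= h x -> forall i, 0 <= f i x.
  by move=> f0x hx i; case: (unliftP ord_max i) => [j|] ->; [apply: f0x|].
have extend c (l : 'I_k -> R) : 0 <= c -> (forall i, 0 <= l i) ->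
    (forall x, g x = c * h x + \sum_i l i * f0 i x) ->
    exists l' : 'I_k.+1 -> R, (forall i, 0 <= l' i) /\
      forall x, g x = \sum_i l' i * f i x.
  move=> c_ge0 l_ge0 gE; exists (fun i => oapp l c (unlift ord_max i)).
  split=> [i|x]; first by case: unlift => [j|] /=.
  rewrite gE (bigD1_ord ord_max) //= unlift_none; congr (_ + _).
  by apply: eq_bigr => i _; rewrite liftK.
have [g_f0|] := pselect (forall x, (forall i, 0 <= f0 i x) -> 0 <= g x).
  have [l [l_ge0 gE]] := IHk f0 g f0_lin g_lin g_f0.
  by apply: (extend 0 l) => // x; rewrite mul0r add0r.
move/existsNP => [x0 /not_implyP [f0x0 /negP]]; rewrite -ltNge => gx0.
have hx0 : h x0 < 0.
  by rewrite ltNge; apply/negP => hx0; have := fg _ (f_split _ f0x0 hx0); lra.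
(* The projection onto the kernel of [h] along [x0]. *)
pose p x := comb (- (h x / h x0)) x0 x.
have pE q x : lin q -> q (p x) = q x - q x0 / h x0 * h x.
  by move=> q_lin; rewrite /p q_lin; ring.
have hp x : h (p x) = 0 by rewrite pE //; field; lra.
have p_lin q : lin q -> lin (q \o p).
  by move=> q_lin a x y; rewrite /= !pE // q_lin h_lin; ring.
have [|x f0x|l [l_ge0 gE]] :=
    IHk (fun i => f0 i \o p) (g \o p) _ (p_lin _ g_lin).
- by move=> i; apply: p_lin.
- by apply: fg; apply: f_split => //; rewrite hp.
(* The multiplier of [h] is forced by evaluating the desired identity at [x0]; it is a quotient of
   two negative numbers. *)
apply: (extend ((g x0 - \sum_i l i * f0 i x0) / h x0) l) => // [|x].
  rewrite -mulrNN -invrN; apply: mulr_ge0; last by rewrite invr_ge0; lra.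
  have : 0 <= \sum_i l i * f0 i x0.
    by apply: sumr_ge0 => i _; apply: mulr_ge0.
  by lra.
have := gE x; rewrite /= pE //.
under eq_bigr do rewrite pE // mulrBr mulrA mulrA.
by rewrite sumrB -!mulr_suml => /eqP; rewrite subr_eq => /eqP ->; ring.
Qed.

Lemma farkas (I : finType) (f : I -> V -> R) (g : V -> R) :
  (forall i, lin (f i)) -> lin g ->
  (forall x, (forall i, 0 <= f i x) -> 0 <= g x) ->
  exists l : I -> R, (forall i, 0 <= l i) /\
    forall x, g x = \sum_i l i * f i x.
Proof.
move=> f_lin g_lin fg.
have [|x f_ge0|l [l_ge0 gE]] :=
    @farkas_ord #|I| (fun i => f (enum_val i)) g _ g_lin.
- by move=> i; apply: f_lin.
- by apply: fg => i; rewrite -(enum_rankK i).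
exists (fun i => l (enum_rank i)); split=> // x.
rewrite gE (reindex (@enum_val I I)); last first.
  by apply: onW_bij; apply: enum_val_bij.
by apply: eq_bigr => i _; rewrite enum_valK.
Qed.

Lemma linear_for0 (f : V -> R) x : lin f -> f (comb (-1) x x) = 0.
Proof. by move=> ->; ring. Qed.

End LinearInequalities.

(** Homogenization: with an extra coordinate [t], infeasibility says that [t >= 0] and all
    [f i x >= b i * t] imply [- t >= 0], and [farkas] applies. *)
Lemma farkas_affine (R : realType) (V : Type) (comb : R -> V -> V -> V)
    (x0 : V) (I : finType) (f : I -> V -> R) (b : I -> R) :
  (forall i, linear_for comb (f i)) ->
  ~ (exists x, forall i, b i <= f i x) ->
  exists l : I -> R, [/\ forall i, 0 <= l i,
    forall x, \sum_i l i * f i x = 0 & 0 < \sum_i l i * b i].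
Proof.
move=> f_lin infeas.
pose comb' a (p q : V * R) := (comb a p.1 q.1, a * p.2 + q.2).
pose F (i : 'I_1 + I) (p : V * R) :=
  if i is inr j then f j p.1 - b j * p.2 else p.2.
have F_lin i : linear_for comb' (F i).
  by case: i => i a p q //=; rewrite f_lin; ring.
have [|p F_ge0|l [l_ge0 lE]] := farkas (g := fun p => - p.2) F_lin.
- by move=> a p q /=; ring.
- rewrite leNgt; apply/negP; rewrite oppr_lt0 => p_gt0; apply: infeas.
  (* [comb (-1) p.1 p.1] serves as the zero vector, so this point is [p.1] divided by [p.2]. *)
  exists (comb p.2^-1 p.1 (comb (-1) p.1 p.1)) => i.
  rewrite f_lin (linear_for0 _ (f_lin i)) addr0 mulrC ler_pdivlMr //.
  by have := F_ge0 (inr i); rewrite /= subr_ge0.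
have lE' x t : - t = l (inl ord0) * t
    + (\sum_i l (inr i) * f i x - (\sum_i l (inr i) * b i) * t).
  rewrite [LHS](lE (x, t)) big_sumType big_ord1 /=; congr (_ + _).
  by rewrite mulr_suml -sumrB; apply: eq_bigr => i _; ring.
have l0 x : \sum_i l (inr i) * f i x = 0 by have := lE' x 0; lra.
exists (l \o inr); split=> // [i|]; first exact: l_ge0.
(* At [t = 1] the identity says that the weighted sum of the [b i] equals [1 + l (inl ord0)]. *)
by have := lE' x0 1; have := l_ge0 (inl ord0); rewrite l0 /=; lra.
Qed.

(** * Trichotomy of outcomes and attainment of finite optima *)

Section FundamentalTheorem.
Variables (R : realType) (V : Type) (comb : R -> V -> V -> V).
Variables (I : finType) (f : I -> V -> R) (b : I -> R) (L : lp R V).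
Hypothesis f_lin : forall i, linear_for comb (f i).
Hypothesis objective_lin : linear_for comb (objective L).
Hypothesis feasibleP : forall x, feasible L x <-> forall i, b i <= f i x.
Hypothesis recessionP : forall x, recession L x <-> forall i, 0 <= f i x.

(** Without an improving ray, Farkas writes the objective as a nonnegative combination of the rows,
    which bounds it below. The infimum is attained, since a certificate against attainment would
    prove a larger lower bound. *)
Lemma min_outcome_exists : exists o, min_outcome L o.
Proof.
have [[x0 Lx0]|infeas] := pselect (exists x, feasible L x); last first.
  by exists Infeasible => x Lx; apply: infeas; exists x.
have [[r [Lr r_lt0]]|bounded] :=
    pselect (exists r, recession L r /\ objective L r < 0).
  by exists (Unbounded x0 r).
have [|l [l_ge0 objE]] := farkas f_lin objective_lin.
  move=> r /recessionP Lr; rewrite leNgt; apply/negP => r_lt0.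
  by apply: bounded; exists r.
pose E := [set objective L x | x in feasible L]%classic.
have E_lb : has_lbound E.
  exists (\sum_i l i * b i) => _ [x /feasibleP Lx <-]; rewrite objE.
  by apply: ler_sum => i _; apply: ler_wpM2l.
have E_nonempty : nonempty E by exists (objective L x0), x0.
have inf_le x : feasible L x -> inf E <= objective L x.
  by move=> Lx; apply: ge_inf => //; exists x.
(* The rows, joined by the demand that the objective be at most its infimum. *)
pose f' (i : 'I_1 + I) x := if i is inr j then f j x else - objective L x.
pose b' (i : 'I_1 + I) := if i is inr j then b j else - inf E.
have [[x x_opt]|no_opt] := pselect (exists x, forall i, b' i <= f' i x).
  have Lx : feasible L x by apply/feasibleP => i; apply: (x_opt (inr i)).
  exists (Optimal x); split=> // y /inf_le; apply: le_trans.
  by have := x_opt (inl ord0); rewrite /= lerN2.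
have [|k [k_ge0 k0 kb]] := farkas_affine (comb := comb) x0 _ no_opt.
  by case=> i a x y /=; rewrite ?objective_lin ?f_lin; ring.
move: kb; rewrite big_sumType big_ord1 /=.
set mu := k (inl ord0); set kb := \sum_i _ => mu_kb.
have mu_ge0 : 0 <= mu := k_ge0 _.
have le_kb x : feasible L x -> kb <= mu * objective L x.
  move=> /feasibleP Lx; have := k0 x; rewrite big_sumType big_ord1 /= -/mu.
  suff : kb <= \sum_i k (inr i) * f i x by lra.
  by apply: ler_sum => i _; apply: ler_wpM2l.
(* With [mu = 0] the certificate would refute the original rows, which [x0] satisfies. *)
have mu_gt0 : 0 < mu.
  rewrite lt_def mu_ge0 andbT; apply/eqP => mu0.
  by have := le_kb _ Lx0; rewrite mu0 in mu_kb *; lra.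
(* [kb / mu] is a lower bound of the objective, yet [mu_kb] places it above the infimum. *)
have : kb / mu <= inf E.
  apply: lb_le_inf => // _ [x Lx <-].
  by rewrite ler_pdivrMr // mulrC; apply: le_kb.
by rewrite ler_pdivrMr //; lra.
Qed.

End FundamentalTheorem.

Lemma max_outcome_exists (R : realType) (V : Type) (comb : R -> V -> V -> V)
    (I : finType) (f : I -> V -> R) (b : I -> R) (L : lp R V) :
  (forall i, linear_for comb (f i)) -> linear_for comb (objective L) ->
  (forall x, feasible L x <-> forall i, b i <= f i x) ->
  (forall x, recession L x <-> forall i, 0 <= f i x) ->
  exists o, max_outcome L o.
Proof.
move=> f_lin obj_lin feasP recP.
pose L' := LP (feasible L) (recession L) (fun x => - objective L x).
have [|o o_min] := min_outcome_exists (L := L') f_lin _ feasP recP.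
  by move=> a x y /=; rewrite obj_lin; ring.
exists o; case: o o_min => [|p r|p] //=; first by rewrite oppr_lt0.
by case=> Lp p_opt; split=> // q /p_opt; rewrite lerN2.
Qed.

(** * Inner products and level-indexed families of vectors *)

Section Blocks.
Variables (R : realType).

Lemma dotE k (u v : 'cV[R]_k) : dot u v = \sum_r u r 0 * v r 0.
Proof. by rewrite /dot mxE; apply: eq_bigr => r _; rewrite mxE. Qed.

Lemma dotC k (u v : 'cV[R]_k) : dot u v = dot v u.
Proof. by rewrite !dotE; apply: eq_bigr => r _; rewrite mulrC. Qed.

Lemma dot_linear_r k (u : 'cV[R]_k) a v v' :
  dot u (a *: v + v') = a * dot u v + dot u v'.
Proof. by rewrite /dot mulmxDr -scalemxAr !mxE. Qed.

Lemma dotDr k (u v v' : 'cV[R]_k) : dot u (v + v') = dot u v + dot u v'.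
Proof. by rewrite -[v]scale1r dot_linear_r mul1r scale1r. Qed.

Lemma dotNr k (u v : 'cV[R]_k) : dot u (- v) = - dot u v.
Proof. by rewrite /dot mulmxN mxE. Qed.

Lemma dot_linear_l k (v : 'cV[R]_k) a u u' :
  dot (a *: u + u') v = a * dot u v + dot u' v.
Proof. by rewrite dotC dot_linear_r !(dotC v). Qed.

Lemma dot0 k (u : 'cV[R]_k) : dot u 0 = 0.
Proof. by rewrite /dot mulmx0 mxE. Qed.

Lemma dot_sumr k (I : finType) (A : pred I) (u : 'cV[R]_k)
    (v : I -> 'cV[R]_k) :
  dot u (\sum_(j | A j) v j) = \sum_(j | A j) dot u (v j).
Proof. by rewrite /dot mulmx_sumr summxE. Qed.

Lemma dot_mulmx k l (y : 'cV[R]_k) (M : 'M[R]_(k, l)) x :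
  dot y (M *m x) = dot (M^T *m y) x.
Proof. by rewrite /dot trmx_mul trmxK mulmxA. Qed.

Lemma dot_ge0 k (u v : 'cV[R]_k) : 0 <=v u -> 0 <=v v -> 0 <= dot u v.
Proof.
move=> u_ge0 v_ge0; rewrite dotE; apply: sumr_ge0 => r _; apply: mulr_ge0.
  by have := u_ge0 r; rewrite mxE.
by have := v_ge0 r; rewrite mxE.
Qed.

Variables (n : nat).
Implicit Types d : 'I_n -> nat.

Definition entry d (x : forall i, 'cV[R]_(d i))
    (p : {i : 'I_n & 'I_(d i)}) : R :=
  x (tag p) (tagged p) 0.

(** Regroups Farkas multipliers, one per scalar row, into one dual vector per level. *)
Definition of_entries d (l : {i : 'I_n & 'I_(d i)} -> R) i : 'cV[R]_(d i) :=
  \col_r l (Tagged (fun i => 'I_(d i)) r).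

Lemma sum_entry d (l : {i : 'I_n & 'I_(d i)} -> R) x :
  \sum_p l p * entry x p = \sum_i dot (of_entries l i) (x i).
Proof.
under [RHS]eq_bigr do rewrite dotE.
rewrite sig_big_dep; apply: eq_bigr => -[i r] _.
by rewrite /of_entries mxE.
Qed.

Lemma entryP d (x y : forall i, 'cV[R]_(d i)) :
  (forall i, x i <=v y i) <-> forall p, entry x p <= entry y p.
Proof.
split=> [le_xy [i r]|le_xy i r]; first exact: le_xy.
exact: (le_xy (Tagged _ r)).
Qed.

Lemma entry_ge0P d (x : forall i, 'cV[R]_(d i)) :
  (forall i, 0 <=v x i) <-> forall p, 0 <= entry x p.
Proof.
by rewrite (entryP (fun=> 0)); split=> x_ge0 p; have := x_ge0 p;
  rewrite /entry mxE.
Qed.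

Lemma of_entries_ge0 d (l : {i : 'I_n & 'I_(d i)} -> R) :
  (forall p, 0 <= l p) -> forall i, 0 <=v of_entries l i.
Proof. by move=> l_ge0 i r; rewrite !mxE. Qed.

(** A Farkas certificate is an identity of functionals; comparing coefficients on unit vectors turns
    it into sign conditions. *)
Lemma ge0_of_entries d (l : {i : 'I_n & 'I_(d i)} -> R)
    (a : forall i, 'cV[R]_(d i)) :
  (forall p, 0 <= l p) ->
  (forall x : forall i, 'cV[R]_(d i),
     \sum_i dot (a i) (x i) = \sum_i dot (of_entries l i) (x i)) ->
  forall i, 0 <=v a i.
Proof.
move=> l_ge0 aE i r; rewrite mxE.
(* [delta] is the unit vector at row [r] of block [i]; comparing natural numbers
   avoids a cast between the dimensions [d i] and [d j]. *)
pose delta j : 'cV[R]_(d j) := \col_s ((j == i) && (s == r :> nat))%:R.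
have dot_delta (c : forall i, 'cV[R]_(d i)) :
    \sum_j dot (c j) (delta j) = c i r 0.
  rewrite (bigD1 i) //= big1 ?addr0 => [|j /negPf ji].
    rewrite dotE (bigD1 r) //= big1 ?addr0 => [|s /negPf sr].
      by rewrite mxE !eqxx mulr1.
    by rewrite mxE eqxx val_eqE sr mulr0.
  by rewrite dotE big1 // => s _; rewrite mxE ji mulr0.
by rewrite -dot_delta aE dot_delta mxE.
Qed.

Lemma entry_linear d (a : R) (x y z : forall i, 'cV[R]_(d i)) :
  (forall i, z i = a *: x i + y i) ->
  forall p, entry z p = a * entry x p + entry y p.
Proof. by move=> zE p; rewrite /entry zE !mxE. Qed.

End Blocks.

(** * Adjoint lower-level operators; BSP1 and BSP2 as finite systems of rows *)

Section BendersSubproblem.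
Variables (R : realType) (n m : nat) (P : data R n m) (gamma : R).

Lemma primal_lhs_linear a (x x' : xvar P) i :
  primal_lhs (fun j => a *: x j + x' j) i
  = a *: primal_lhs x i + primal_lhs x' i.
Proof.
rewrite /primal_lhs mulmxDr -scalemxAr.
under eq_bigr do rewrite mulmxDr -scalemxAr.
by rewrite big_split /= -scaler_sumr scalerDr addrACA.
Qed.

Lemma dual_lhs_linear a (y y' : yvar P) i :
  dual_lhs (fun j => a *: y j + y' j) i = a *: dual_lhs y i + dual_lhs y' i.
Proof.
rewrite /dual_lhs mulmxDr -scalemxAr.
under eq_bigr do rewrite mulmxDr -scalemxAr.
by rewrite big_split /= -scaler_sumr scalerDr addrACA.
Qed.

(** The two staircase operators are adjoint: [B_ P i j] with i = j + 1 acts in row [i] of one and,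
    transposed, in row [j] of the other, so exchanging the double sum matches the terms. *)
Lemma primal_dual_lhs (x : xvar P) (y : yvar P) :
  \sum_i dot (y i) (primal_lhs x i) = \sum_i dot (x i) (dual_lhs y i).
Proof.
rewrite /primal_lhs /dual_lhs.
under eq_bigr do rewrite dotDr dot_mulmx dotC dot_sumr.
under [RHS]eq_bigr do rewrite dotDr dot_sumr.
rewrite !big_split /=; congr (_ + _).
rewrite (exchange_big_dep xpredT) //=; apply: eq_bigr => j _.
by apply: eq_bigr => i _; rewrite dot_mulmx dotC.
Qed.

Lemma primal_lhs0 i : primal_lhs (P := P) (fun=> 0) i = 0.
Proof. by rewrite /primal_lhs mulmx0 big1 ?addr0 // => j _; rewrite mulmx0. Qed.

Definition comb1 (a : R) (s t : var1 P) : var1 P :=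
  Var1 (fun i => a *: x1 s i + x1 t i) (fun i => a *: uy1 s i + uy1 t i)
       (fun i => a *: v1 s i + v1 t i) (a *: u1 s + u1 t).

Definition comb2 (a : R) (s t : var2 P) : var2 P :=
  Var2 (fun i => a *: y2 s i + y2 t i) (fun i => a *: ux2 s i + ux2 t i)
       (a * w2 s + w2 t).

Lemma scale1E a (t : var1 P) : scale1 a t = comb1 a t (zero1 P).
Proof.
congr Var1; rewrite ?addr0 //.
all: by apply: functional_extensionality_dep => i; rewrite addr0.
Qed.

Local Notation index d := {i : 'I_n & 'I_(d i)}.

Definition lhs1 (t : var1 P) i : 'cV[R]_(dy P i) :=
  primal_lhs (x1 t) i - (G_y P i)^T *m uy1 t i - (Y_y P i)^T *m v1 t i
    - (gam gamma i)^-1 *: ((S_y P i)^T *m u1 t).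

(** One index per scalar inequality: the signs of [x], [u_y], [v_y], [u], the rows bounded below by
    [b_], and the [K_y] rows, which [row1] negates into lower bounds. *)
Definition index1 : finType :=
  (index (dx P) + (index (duy P) + (index (dv P) + ('I_(du P)
    + (index (dy P) + index (ds P))))))%type.

Definition row1 (k : index1) (t : var1 P) : R :=
  match k with
  | inl p => entry (x1 t) p
  | inr (inl p) => entry (uy1 t) p
  | inr (inr (inl p)) => entry (v1 t) p
  | inr (inr (inr (inl r))) => u1 t r 0
  | inr (inr (inr (inr (inl p)))) => entry (lhs1 t) p
  | inr (inr (inr (inr (inr p)))) =>
      entry (fun i => - ((K_y P i)^T *m v1 t i)) p
  end.

Definition rhs1 (k : index1) : R :=
  match k with
  | inr (inr (inr (inr (inl p)))) => entry (b_ P) p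
  | inr (inr (inr (inr (inr p)))) => -1
  | _ => 0
  end.

Lemma row1_linear k : linear_for comb1 (row1 k).
Proof.
move=> a s t; case: k => [p|[p|[p|[r|[p|p]]]]] /=;
  try by apply: entry_linear.
- by rewrite !mxE.
- apply: entry_linear => i.
  rewrite /lhs1 primal_lhs_linear !mulmxDr -!scalemxAr.
  by apply/colP => r; rewrite !mxE; ring.
- apply: entry_linear => i; rewrite !mulmxDr -!scalemxAr.
  by apply/colP => r; rewrite !mxE; ring.
Qed.

Lemma constr1P w t : constr1 gamma w t <-> forall k, w * rhs1 k <= row1 k t.
Proof.
split=> [[t_ge0 u_ge0 row_t col_t]|rows].
  move=> [p|[p|[p|[r|[p|p]]]]] /=; rewrite ?mulr0.
  - by move: p; apply/entry_ge0P => i; case: (t_ge0 i).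
  - by move: p; apply/entry_ge0P => i; case: (t_ge0 i).
  - by move: p; apply/entry_ge0P => i; case: (t_ge0 i).
  - by have := u_ge0 r; rewrite mxE.
  - by have := row_t (tag p) (tagged p); rewrite /entry /lhs1 !mxE.
  - by have := col_t (tag p) (tagged p); rewrite /entry /ones !mxE; lra.
split=> [i||i|i].
- split; move: i; apply/entry_ge0P => p.
  + by have := rows (inl p); rewrite /= mulr0.
  + by have := rows (inr (inl p)); rewrite /= mulr0.
  + by have := rows (inr (inr (inl p))); rewrite /= mulr0.
- by move=> r; have := rows (inr (inr (inr (inl r)))); rewrite /= mulr0 mxE.
- move=> r; have := rows (inr (inr (inr (inr (inl (Tagged _ r)))))).
  by rewrite /= /entry /= /lhs1 !mxE.
- move=> r; have := rows (inr (inr (inr (inr (inr (Tagged _ r)))))).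
  by rewrite /= /entry /= /ones !mxE; lra.
Qed.

Lemma constr1_comb a w w' s t : 0 <= a ->
  constr1 gamma w s -> constr1 gamma w' t ->
  constr1 gamma (a * w + w') (comb1 a s t).
Proof.
move=> a_ge0 /constr1P Cs /constr1P Ct; apply/constr1P => k.
rewrite row1_linear mulrDl -mulrA; apply: lerD => //.
exact: ler_wpM2l.
Qed.

Lemma constr1_zero : constr1 gamma 0 (zero1 P).
Proof.
apply/constr1P => k.
(* Linearity over [comb1] yields the value 0 at points [comb1 (-1) s s], so zero is put in that
   form. *)
rewrite mul0r (_ : zero1 P = comb1 (-1) (zero1 P) (zero1 P)).
  by rewrite (linear_for0 _ (row1_linear k)).
rewrite -scale1E; congr Var1; rewrite ?scaler0 //.
all: by apply: functional_extensionality_dep => i; rewrite scaler0.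
Qed.

Lemma constr1_scale a (t : var1 P) : 0 <= a -> constr1 gamma 1 t ->
  constr1 gamma a (scale1 a t).
Proof.
move=> a_ge0 Ct; have := constr1_comb a_ge0 Ct constr1_zero.
by rewrite mulr1 addr0 -scale1E.
Qed.

Lemma objective1_linear z : linear_for comb1 (@objective1 R n m P gamma z).
Proof.
move=> a s t; rewrite /objective1 dot_linear_l.
rewrite mulrBr mulr_sumr opprD addrACA -big_split /=; congr (_ + _).
apply: eq_bigr => i _; rewrite dot_linear_r !dot_linear_l; ring.
Qed.

Lemma objective1_zero z : objective1 gamma z (zero1 P) = 0.
Proof.
rewrite /objective1 dotC dot0 subr0 big1 // => i _.
by rewrite dot0 !(dotC 0) !dot0; ring.
Qed.

Lemma objective1_scale z a (t : var1 P) :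
  objective1 gamma z (scale1 a t) = a * objective1 gamma z t.
Proof. by rewrite scale1E objective1_linear objective1_zero addr0. Qed.

(** The slack of the dual rows without its constant [c_x] term, which passes into [rhs2] with a
    minus sign. *)
Definition lhs2 (t : var2 P) i : 'cV[R]_(dx P i) :=
  (gam gamma i * w2 t) *: c_ P i - (dual_lhs (y2 t) i + (G_x P i)^T *m ux2 t i).

Definition index2 : finType :=
  (index (dy P) + (index (dux P) + ('I_1 + ('I_1 + index (dx P)))))%type.

(* With [w0 = true] the fourth block forces [w] to vanish. *)
Definition row2 (w0 : bool) (k : index2) (t : var2 P) : R :=
  match k with
  | inl p => entry (y2 t) p
  | inr (inl p) => entry (ux2 t) p
  | inr (inr (inl _)) => w2 t
  | inr (inr (inr (inl _))) => if w0 then - w2 t else 0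
  | inr (inr (inr (inr p))) => entry (lhs2 t) p
  end.

Definition rhs2 (k : index2) : R :=
  if k is inr (inr (inr (inr p))) then - (gamma * entry (c_x P) p) else 0.

Lemma row2_linear w0 k : linear_for comb2 (row2 w0 k).
Proof.
move=> a s t; case: k => [p|[p|[r|[r|p]]]] /=; try by apply: entry_linear.
- by [].
- by case: w0; rewrite /= ?mulr0 ?addr0 // opprD mulrN.
- apply: entry_linear => i; rewrite /lhs2 /= dual_lhs_linear mulmxDr -scalemxAr.
  by apply/colP => r; rewrite !mxE; ring.
Qed.

Lemma constr2P (w0 : bool) h (t : var2 P) :
  constr2 gamma h t /\ (w0 -> w2 t = 0)
  <-> forall k, h * rhs2 k <= row2 w0 k t.
Proof.
split=> [[[t_ge0 w_ge0 row_t] w_eq0]|rows].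
  move=> [p|[p|[r|[r|p]]]] /=; rewrite ?mulr0 //.
  - by move: p; apply/entry_ge0P => i; case: (t_ge0 i).
  - by move: p; apply/entry_ge0P => i; case: (t_ge0 i).
  - by case: w0 w_eq0 => // ->; rewrite ?oppr0.
  - by have := row_t (tag p) (tagged p); rewrite /entry !mxE; lra.
have w_ge0 : 0 <= w2 t by have := rows (inr (inr (inl ord0))); rewrite /= mulr0.
split; last first.
  move=> w0T; have := rows (inr (inr (inr (inl ord0)))).
  by rewrite /= w0T mulr0; lra.
split=> // [i|i].
- split; move: i; apply/entry_ge0P => p.
  + by have := rows (inl p); rewrite /= mulr0.
  + by have := rows (inr (inl p)); rewrite /= mulr0.
- move=> r; have := rows (inr (inr (inr (inr (Tagged _ r))))).
  by rewrite /= /entry /= !mxE; lra.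
Qed.

Lemma objective2_linear z d : linear_for comb2 (objective (BSP2 P gamma z d)).
Proof.
move=> a s t; rewrite /= /objective2.
rewrite mulrBr mulr_sumr mulrDl opprD mulrA addrACA -big_split /=.
congr (_ + _).
by apply: eq_bigr => i _; rewrite !dot_linear_l; ring.
Qed.

(** * Outcomes and feasibility of BSP1 and BSP2 *)

Lemma BSP1_outcome_exists z : exists o, min_outcome (BSP1 P gamma z) o.
Proof.
apply: (min_outcome_exists row1_linear (b := rhs1)).
- exact: objective1_linear.
- move=> t; rewrite /= constr1P.
  by split=> rows k; have := rows k; rewrite mul1r.
- move=> t; rewrite /= constr1P.
  by split=> rows k; have := rows k; rewrite mul0r.
Qed.

Lemma BSP2_outcome_exists z d : exists o, max_outcome (BSP2 P gamma z d) o.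
Proof.
have doo t : (d = +oo%E -> w2 t = 0) <-> ((d == +oo%E) -> w2 t = 0 :> R).
  by split=> H /eqP; rewrite ?eqE //=; apply: H.
apply: (max_outcome_exists (row2_linear (d == +oo%E)) (b := rhs2)).
- exact: objective2_linear.
- move=> t; rewrite /= doo constr2P.
  by split=> rows k; have := rows k; rewrite mul1r.
- move=> t; rewrite /= doo constr2P.
  by split=> rows k; have := rows k; rewrite mul0r.
Qed.

(* A Farkas certificate of infeasibility of BSP1 contains a recession direction
   (y, s) of the McCormick system, hence with s^T 1 = y^T D z, while y prices
   the lower-level constraints at a positive value: the lower levels would be
   infeasible. *)
Lemma BSP1_feasible z : slater P z -> linearizes P gamma z ->
  exists t : var1 P, constr1 gamma 1 t.
Proof.
move=> [x slater_x] lin_z; apply: contrapT => infeas.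
have [|l [l_ge0 l0 lb]] := farkas_affine (zero1 P) (b := rhs1) row1_linear.
  move=> [t rows]; apply: infeas; exists t.
  by apply/constr1P => k; rewrite mul1r.
pose y := of_entries (fun p => l (inr (inr (inr (inr (inl p)))))).
pose s := of_entries (fun p => l (inr (inr (inr (inr (inr p)))))).
have y_ge0 i : 0 <=v y i by apply: of_entries_ge0.
have s_ge0 i : 0 <=v s i by apply: of_entries_ge0.
pose ax := of_entries (fun p => l (inl p)).
pose av := of_entries (fun p => l (inr (inr (inl p)))).
(* The certificate vanishes everywhere; here it is tested at the point whose only nonzero block is
   the Slater point. *)
have id_x : \sum_i dot (ax i) (x i) + \sum_i dot (y i) (primal_lhs x i) = 0.
  rewrite -[RHS](l0 (Var1 x (fun=> 0) (fun=> 0) 0)) !big_sumType /= !sum_entry.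
  rewrite [X in _ = _ + (X + _)]big1 => [|i _]; last by rewrite dot0.
  rewrite [X in _ = _ + (_ + (X + _))]big1 => [|i _]; last by rewrite dot0.
  rewrite [X in _ = _ + (_ + (_ + (X + _)))]big1 => [|i _]; last first.
    by rewrite mxE mulr0.
  rewrite [X in _ = _ + (_ + (_ + (_ + (_ + X))))]big1 => [|i _]; last first.
    by rewrite mulmx0 oppr0 dot0.
  rewrite !add0r addr0; congr (_ + _); apply: eq_bigr => i _.
  by rewrite /lhs1 /= !mulmx0 scaler0 !subr0.
(* Tested on [v] alone, it identifies the multipliers of [v >= 0] with [Y_y y + K_y s], so [(y, s)]
   is a McCormick recession direction. *)
have id_v (v : vvar P) : \sum_i dot (Y_y P i *m y i + K_y P i *m s i) (v i) =
    \sum_i dot (av i) (v i).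
  apply/eqP; rewrite eq_sym -subr_eq0 -sumrN; apply/eqP.
  rewrite -[RHS](l0 (Var1 (fun=> 0) (fun=> 0) v 0)) !big_sumType /= !sum_entry.
  rewrite [X in _ = X + _]big1 => [|i _]; last by rewrite dot0.
  rewrite [X in _ = _ + (X + _)]big1 => [|i _]; last by rewrite dot0.
  rewrite [X in _ = _ + (_ + (_ + (X + _)))]big1 => [|i _]; last first.
    by rewrite mxE mulr0.
  rewrite !add0r; congr (_ + _); rewrite -big_split; apply: eq_bigr => i _ /=.
  rewrite /lhs1 /= primal_lhs0 !mulmx0 scaler0 !subr0 sub0r !dotNr -opprD.
  by rewrite !dot_mulmx !trmxK -!(dotC (v i)) dotDr.
have YK_ge0 : forall i, 0 <=v Y_y P i *m y i + K_y P i *m s i.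
  by apply: ge0_of_entries id_v => p.
(* Exactness holds at a McCormick point and at its translate by [(y, s)]; subtract. *)
have s_ones i : dot (s i) (ones R (ds P i)) = dot (y i) (D_ P i *m z).
  have [[y0 [s0 [y0_ge0 s0_ge0 mc0]]] exact_mc] := lin_z i.
  have E0 := exact_mc y0 s0 (And3 y0_ge0 s0_ge0 mc0).
  have : dot (1 *: s i + s0) (ones R (ds P i))
      = dot (1 *: y i + y0) (D_ P i *m z).
    apply: exact_mc; rewrite !scale1r; split=> r.
    - by have := y_ge0 i r; have := y0_ge0 r; rewrite !mxE; lra.
    - by have := s_ge0 i r; have := s0_ge0 r; rewrite !mxE; lra.
    - rewrite !mulmxDr; have := mc0 r; have := YK_ge0 i r.
      by rewrite /GRing.scale /= !mxE; lra.
  by rewrite !dot_linear_l E0; lra.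
move: lb; rewrite !big_sumType /=.
do 4 ![rewrite [X in _ < X + _]big1 ?add0r; last by move=> *; rewrite mulr0].
rewrite sum_entry.
have -> : \sum_p l (inr (inr (inr (inr (inr p))))) * -1 =
    - \sum_i dot (y i) (D_ P i *m z).
  under [in RHS]eq_bigr do rewrite -s_ones.
  rewrite -sum_entry -sumrN; apply: eq_bigr => p _.
  by rewrite /entry /ones mxE mulrN.
have : 0 <= \sum_i dot (ax i) (x i).
  apply: sumr_ge0 => i _; apply: dot_ge0; first exact: of_entries_ge0.
  by move=> r; apply: ltW; case: (slater_x i).
(* Weak duality at the Slater point: by [id_x], [y] prices [primal_lhs x] at a nonpositive value,
   while the certificate prices [b - D z] positively. *)
suff : \sum_i dot (y i) (b_ P i) <=
    \sum_i dot (y i) (primal_lhs x i) + \sum_i dot (y i) (D_ P i *m z) by lra.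
rewrite -big_split; apply: ler_sum => i _ /=.
rewrite -dotDr -subr_ge0 -dotNr -dotDr.
apply: dot_ge0 => // r; have [_ /(_ r)] := slater_x i.
by rewrite !mxE; lra.
Qed.

(* A Farkas certificate of infeasibility of the constraints of BSP2 with w = 0
   is a ray x along which the upper level would be unbounded. *)
Lemma BSP2_feasible : 0 < gamma -> relaxation_feasible_bounded P ->
  exists t : var2 P, constr2 gamma 1 t /\ w2 t = 0.
Proof.
move=> gamma_gt0 [[z0 [x0 [y0 feas0]]] [lo lo_le]]; apply: contrapT => infeas.
have [|l [l_ge0 l0 lb]] :=
    farkas_affine (zero2 P) (b := rhs2) (row2_linear true).
  move=> [t rows]; apply: infeas; exists t.
  have [|C w0] := (constr2P true 1 t).2; first by move=> k; rewrite mul1r.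
  by split=> //; apply: w0.
pose x := of_entries (fun p => l (inr (inr (inr (inr p))))).
have x_ge0 i : 0 <=v x i by apply: of_entries_ge0.
(* Tested at [w = 0], the certificate identifies the multipliers of [y >= 0] and [u_x >= 0] with
   [primal_lhs x] and [G_x x]. *)
have id_t (y : yvar P) (u : uxvar P) :
    \sum_i dot (of_entries (fun p => l (inl p)) i) (y i)
    + \sum_i dot (of_entries (fun p => l (inr (inl p))) i) (u i)
    = \sum_i dot (primal_lhs x i) (y i) + \sum_i dot (G_x P i *m x i) (u i).
  have := l0 (Var2 y u 0); rewrite !big_sumType /= !sum_entry.
  rewrite !big_ord1 oppr0 !mulr0 !add0r.
  suff -> : \sum_i dot (x i) (lhs2 (Var2 y u 0) i) =
      - (\sum_i dot (primal_lhs x i) (y i)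
         + \sum_i dot (G_x P i *m x i) (u i)) by lra.
  under [in RHS]eq_bigr do rewrite dotC.
  rewrite primal_dual_lhs -big_split -sumrN; apply: eq_bigr => i _ /=.
  rewrite /lhs2 /= mulr0 scale0r sub0r dotNr dotDr.
  by rewrite [dot _ (_^T *m _)]dot_mulmx trmxK.
have Ax_ge0 : forall i, 0 <=v primal_lhs x i.
  apply: (ge0_of_entries (l := fun p => l (inl p))) => // y.
  have := id_t y (fun=> 0).
  by do 2 ![rewrite [X in _ + X]big1 ?addr0; last by move=> *; rewrite dot0].
have Gx_ge0 : forall i, 0 <=v G_x P i *m x i.
  apply: (ge0_of_entries (l := fun p => l (inr (inl p)))) => // u.
  have := id_t (fun=> 0) u.
  by do 2 ![rewrite [X in X + _]big1 ?add0r; last by move=> *; rewrite dot0].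
pose c := \sum_i dot (c_x P i) (x i).
have c_lt0 : c < 0.
  rewrite -(pmulr_rlt0 _ gamma_gt0) -oppr_gt0; move: lb.
  rewrite !big_sumType /=.
  do 4 ![rewrite [X in _ < X + _]big1 ?add0r; last by move=> *; rewrite mulr0].
  have -> // : \sum_p l (inr (inr (inr (inr p)))) * - (gamma * entry (c_x P) p)
      = - (gamma * c).
  rewrite /c; under [in RHS]eq_bigr do rewrite dotC.
  by rewrite -sum_entry mulr_sumr -sumrN; apply: eq_bigr => p _; ring.
have c_neq0 : c != 0 by rewrite lt_eqF.
(* This step length along [x] brings the objective down to exactly [lo - 1]. *)
pose a := (relaxation_objective z0 x0 - lo + 1) / - c.
have a_ge0 : 0 <= a.
  by apply: divr_ge0; have := lo_le _ _ _ feas0; lra.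
have [up xy_ge0 rows q_le prim] := feas0.
have /lo_le : relaxation_feasible z0 (fun i => a *: x i + x0 i) y0.
  split=> // [i|i|i].
  - have [x0_ge0 y0_ge0] := xy_ge0 i; split=> // r.
    have := x_ge0 i r; have := x0_ge0 r; rewrite !mxE => x0r xr.
    by apply: addr_ge0 => //; apply: mulr_ge0.
  - have [rows_x rows_y] := rows i; split=> // r.
    have := Gx_ge0 i r; have := rows_x r; rewrite mulmxDr -scalemxAr.
    rewrite [_ 0 r 0 in X in _ -> X -> _]mxE => le1 le2.
    apply: le_trans le1 _; rewrite [leLHS]mxE [leRHS]mxE lerD2l [leRHS]mxE.
    by rewrite lerDr mxE mulr_ge0.
  - move=> r; have := Ax_ge0 i r; have := prim i r; rewrite primal_lhs_linear.
    rewrite !mxE => le1 le2; have := mulr_ge0 a_ge0 le2; lra.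
have -> : relaxation_objective z0 (fun i => a *: x i + x0 i)
    = relaxation_objective z0 x0 + a * c.
  rewrite /relaxation_objective; under eq_bigr do rewrite dot_linear_r.
  by rewrite big_split /= -mulr_sumr -/c; ring.
rewrite (_ : a * c = - (relaxation_objective z0 x0 - lo + 1)); first by lra.
by rewrite /a invrN mulrN mulNr mulfVK.
Qed.

(** * Recombining the two outcomes into one of BSP *)

Lemma constr2_zero : constr2 gamma 0 (zero2 P).
Proof.
split=> [i||i] //=; first by split=> r; rewrite mxE.
rewrite /dual_lhs !mulmx0 big1 => [|j _]; last by rewrite mulmx0.
by rewrite mulr0 mul0r !scale0r !addr0 => r.
Qed.

(** For [w > 0], [t] divided by [w] is feasible for BSP1. For [w = 0], adding [t] to [p] keeps
    feasibility, so optimality of [p] forbids a negative objective at [t]. *)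
Lemma objective1_ge z p w (t : var1 P) :
  min_outcome (BSP1 P gamma z) (Optimal p) ->
  0 <= w -> constr1 gamma w t -> w * objective1 gamma z p <= objective1 gamma z t.
Proof.
move=> [/= Cp p_opt]; rewrite le_eqVlt => /predU1P[<-|w_gt0] Ct.
  have /p_opt : constr1 gamma 1 (comb1 1 t p).
    by have := constr1_comb ler01 Ct Cp; rewrite mulr0 add0r.
  by rewrite objective1_linear; lra.
have /p_opt : constr1 gamma 1 (scale1 w^-1 t).
  have w_inv_ge0 : 0 <= w^-1 by rewrite invr_ge0 ltW.
  have := constr1_comb w_inv_ge0 Ct constr1_zero.
  by rewrite -scale1E addr0 mulVf // lt0r_neq0.
by rewrite objective1_scale mulrC ler_pdivlMr // mulrC.
Qed.

End BendersSubproblem.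

Theorem theorem3p1 (R : realType) (n m : nat) (P : data R n m) (gamma : R)
    (zhat : 'cV[R]_m) :
  (2 <= n)%N ->
  0 < gamma < 1 ->
  relaxation_feasible_bounded P ->
  (forall z, upper_decision P z -> slater P z) ->
  (forall z, upper_decision P z -> linearizes P gamma z) ->
  upper_decision P zhat ->
  (exists o1, min_outcome (BSP1 P gamma zhat) o1) /\
  (forall o1, min_outcome (BSP1 P gamma zhat) o1 ->
     (exists o2, max_outcome (BSP2 P gamma zhat (value1 gamma zhat o1)) o2) /\
     (forall o2, max_outcome (BSP2 P gamma zhat (value1 gamma zhat o1)) o2 ->
        max_outcome (BSP P gamma zhat) (combine o1 o2))).
Proof.
move=> _ /andP[gamma_gt0 _] relax slaterP linP z_up.
split; first exact: BSP1_outcome_exists.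
move=> o1 o1_min; split; first exact: BSP2_outcome_exists.
(* [t1] excludes infeasibility of BSP1; [t2], having [w = 0], excludes that of BSP2 when BSP1 is
   unbounded. *)
have [t1 Ct1] := BSP1_feasible (slaterP _ z_up) (linP _ z_up).
have [t2 [Ct2 wt2]] := BSP2_feasible gamma_gt0 relax.
move=> o2; case: o1 o1_min => [/(_ t1)//|p1 r1 [_ /= Cr1 r1_lt0]|p1 p1_min].
  case: o2 => [/(_ t2) []|p r [[Cp wp] [Cr wr] r_gt0]|p [[Cp wp] _]] //=.
  - rewrite wp // wr // objective1_zero subr0; split.
    + by split=> //; apply: constr1_zero.
    + by split=> //; apply: constr1_zero.
    + by move: r_gt0; rewrite /= mulr0 subr0.
  - rewrite wp //; split.
    + by split=> //; apply: constr1_zero.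
    + by split=> //; apply: constr2_zero.
    + suff -> : objective2 zhat (zero2 P) = 0 by rewrite sub0r oppr_gt0.
      by rewrite /objective2 big1 // => i _; rewrite !(dotC 0) !dot0 addr0.
have [Cp1 _] := p1_min.
have w_ge0 h (t : var2 P) : constr2 gamma h t -> 0 <= w2 t by case.
case: o2 => [infeas [q t] [/= Cq Ct]|p r [[Cp _] [Cr _] r_gt0]
  |p [[Cp _] p_opt]] /=.
(* The value of BSP1 is finite, so the clause forcing [w = 0] is vacuous and the first part of any
   feasible point of BSP is feasible for BSP2. *)
- by apply: (infeas q); split.
- split; rewrite ?objective1_scale //.
  + by split=> //; apply: constr1_scale => //; apply: w_ge0 Cp.
  + by split=> //; apply: constr1_scale => //; apply: w_ge0 Cr.
- split; first by split=> //; apply: constr1_scale => //; apply: w_ge0 Cp.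
  move=> [q t] /= [Cq Ct]; rewrite objective1_scale.
  (* Bounding the BSP1-part by [w] times the optimum of BSP1 leaves at most the BSP2 objective at
     [q]. *)
  have := objective1_ge p1_min (w_ge0 _ _ Cq) Ct.
  have : objective (BSP2 P gamma zhat (value1 gamma zhat (Optimal p1))) q <=
      objective (BSP2 P gamma zhat (value1 gamma zhat (Optimal p1))) p.
    by apply: p_opt.
  by rewrite /=; lra.
Qed.
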